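(* For each set $A\subseteq\mathbb{R}$ with the Baire property, the set $\Phi_{\mathcal M}(A)$ of all $\mathcal M$-density points of $A$ is a Borel set of type $F_{\sigma\delta}$, i.e. of class $\mathbf{\Pi}^0_3$, in $\mathbb{R}$.
   Context: $\mathbb{N}$ is the set of positive integers. $\mathcal B$ denotes the $\sigma$-algebra of subsets of $\mathbb{R}$ having the Baire property, and $\mathcal M\subseteq\mathcal B$ the $\sigma$-ideal of meager subsets of $\mathbb{R}$. For $A\subseteq\mathbb{R}$ and $\alpha,x\in\mathbb{R}$ write $\alpha A=\{\alpha t: t\in A\}$ and $A-x=\{t-x: t\in A\}$. For a sequence of sets, $\limsup_{k\in\mathbb N} E_k=\bigcap_{p\in\mathbb N}\bigcup_{k\ge p}E_k$. Let $A\in\mathcal B$. The number $0$ is an $\mathcal M$-density point of $A$ if for each (strictly) increasing sequence $(n_k)_{k\in\mathbb N}$ of positive integers there is a subsequence $(n_{i_k})_{k\in\mathbb N}$ such that $\limsup_{k\in\mathbb N}\big((-1,1)\setminus n_{i_k}A\big)\in\mathcal M$. A point $x\in\mathbb{R}$ is an $\mathcal M$-density point of $A$ if $0$ is an $\mathcal M$-density point of $A-x$. $\Phi_{\mathcal M}(A)$ denotes the set of all $\mathcal M$-density points of $A$. A set is of type $F_{\sigma\delta}$ (class $\mathbf{\Pi}^0_3$) if it is a countable intersection of $F_\sigma$ sets, i.e. of countable unions of closed sets. *)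

(* Defs.v *)
From mathcomp Require Import all_boot all_order all_algebra.
From mathcomp Require Import all_classical all_reals all_analysis.
From mathcomp Require Import borel_hierarchy.
Import Order.TTheory GRing.Theory Num.Theory.
Import numFieldNormedType.Exports.

Set Implicit Arguments.
Unset Strict Implicit.
Unset Printing Implicit Defensive.

Local Open Scope classical_set_scope.
Local Open Scope ring_scope.

Section BaireCategory.
Context {T : topologicalType}.
Implicit Types A : set T.

Definition nowhere_dense A := (closure A)° = set0.

Definition meager A :=
  exists2 F : (set T)^nat, (forall i, nowhere_dense (F i)) & A = \bigcup_i F i.

Definition baire_property A := exists2 U : set T, open U & meager (A `+` U).

Definition Fsigmadelta A :=
  exists2 F : (set T)^nat, (forall i, Fsigma (F i)) & A = \bigcap_i F i.

End BaireCategory.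

Section MDensity.
Context {R : realType}.
Implicit Types (A : set R) (x : R).

(* Sequences indexed by the positive integers are indexed here by [nat],
   starting at 0; their values [n k] are positive.  [increasing_seq]
   is strict monotonicity. *)
Definition Mdensity0 A :=
  forall n : nat^nat, (forall k, (0 < n k)%N) -> increasing_seq n ->
  exists2 i : nat^nat, increasing_seq i &
    meager (lim_sup_set (fun k =>
      `]-1, 1[ `\` [set (n (i k))%:R * t | t in A] : set R)).

Definition Mdensity_point A x := Mdensity0 [set t - x | t in A].

Definition PhiM A : set R := [set x | Mdensity_point A x].

End MDensity.

(* Main.v *)
(**
  Up to a meager set the complement of A is an open set H, so x is a density
  point of A iff every increasing sequence n has a subsequence along which the
  open sets O_m = (-1, 1) `&` m (H - x) have a meager limsup.  By Baire's
  theorem, the limsup of a sequence of open sets is meager iff every nonempty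
  open set contains a nonempty open set that misses all but finitely many of
  them.  For a countable pi-base B of the line, this makes x a density point
  iff for all l there is N such that for all m > N some B_j with j < N is
  contained in B_l and disjoint from O_m.  For fixed j and m, disjointness from
  O_m is a closed condition on x, because H is open. *)
Require Import Defs.
From mathcomp Require Import all_boot all_order all_algebra.
From mathcomp Require Import all_classical all_reals all_analysis.
Import Order.TTheory GRing.Theory Num.Theory.
Import numFieldNormedType.Exports.

Set Implicit Arguments.
Unset Strict Implicit.
Unset Printing Implicit Defensive.

Local Open Scope classical_set_scope.
Local Open Scope ring_scope.

(** * Nowhere dense and meager sets *)

Lemma nowhere_denseP (T : topologicalType) (A : set T) :
  nowhere_dense A <->
  forall W : set T, open W -> W !=set0 ->
    exists W' : set T, [/\ open W', W' !=set0, W' `<=` W & W' `&` A = set0].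
Proof.
split=> [ndA W oW [w Ww]|h].
  (* Were this set empty, [w] would be interior to [closure A]. *)
  exists (W `&` ~` closure A); split; last 2 first.
  - exact: subIsetl.
  - by apply/seteqP; split=> // z [[_ nz] Az]; apply: nz; exact: subset_closure.
  - by apply: openI => //; exact/closed_openC/closed_closure.
  apply: contrapT => e.
  have : (closure A)° w.
    rewrite /interior; apply: filterS (open_nbhs_nbhs (conj oW Ww)) => z Wz.
    by apply: contrapT => nz; apply: e; exists z.
  by rewrite ndA.
apply/seteqP; split=> // x xA.
have [|W' [oW' [z W'z] sW' W'A]] := h _ (open_interior (closure A)).
  by exists x.
have /interior_subset cz := sW' _ W'z.
have [y [Ay W'y]] := cz _ (open_nbhs_nbhs (conj oW' W'z)).
have : (W' `&` A) y by [].
by rewrite W'A.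
Qed.

Lemma nowhere_denseS (T : topologicalType) (A B : set T) :
  A `<=` B -> nowhere_dense B -> nowhere_dense A.
Proof.
move=> AB ndB; apply/seteqP; split=> // x.
by rewrite -[set0]ndB; apply: interiorS; exact: closureS.
Qed.

Lemma meagerS (T : topologicalType) (A B : set T) :
  A `<=` B -> meager B -> meager A.
Proof.
move=> AB [F ndF BF]; exists (fun i => A `&` F i).
  by move=> i; apply: nowhere_denseS (ndF i); exact: subIsetr.
by rewrite -setI_bigcupr -BF; apply/esym/setIidPl.
Qed.

Lemma nowhere_dense_meager (T : topologicalType) (A : set T) :
  nowhere_dense A -> meager A.
Proof. by move=> ndA; exists (fun=> A) => //; rewrite bigcup_const. Qed.

Lemma meager_bigcup (T : topologicalType) (F : (set T)^nat) :
  (forall i, meager (F i)) -> meager (\bigcup_i F i).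
Proof.
move=> mF.
have /choice[G hG] i : exists G : (set T)^nat,
    (forall j, nowhere_dense (G j)) /\ F i = \bigcup_j G j.
  by have [G ? ?] := mF i; exists G.
(* Pairs [(i, j)] are coded as numbers; a number coding no pair gets the empty set. *)
pose H k := if unpickle k is Some (i, j) then G i j else set0.
have ndG0 : nowhere_dense (set0 : set T).
  by rewrite /nowhere_dense closure0 interior0.
exists H.
  by move=> k; rewrite /H; case: unpickle => [[i j]|//]; exact: (hG i).1.
apply/seteqP; split=> x [i _].
  rewrite (hG i).2 => -[j _ Gx]; exists (pickle (i, j)) => //.
  by rewrite /H pickleK.
rewrite /H; case: unpickle => [[a b]|//] Gx.
by exists a => //; rewrite (hG a).2; exists b.
Qed.

Lemma meagerU (T : topologicalType) (A B : set T) :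
  meager A -> meager B -> meager (A `|` B).
Proof.
move=> mA mB; rewrite -bigcup2E; apply: meager_bigcup => -[|[|i]] //=.
by apply: meagerS mA.
Qed.

(** Nowhere density is tested on open sets, which a homeomorphism carries back and forth. *)
Lemma meager_preimage (S T : topologicalType) (f : S -> T) (g : T -> S)
    (A : set T) :
  continuous f -> continuous g -> cancel f g -> cancel g f ->
  meager A -> meager (f @^-1` A).
Proof.
move=> cf cg fK gK [F ndF ->]; rewrite preimage_bigcup.
exists (fun i => f @^-1` F i) => // i; apply/nowhere_denseP => W oW [w Ww].
have [||V [oV [v Vv] sV VF]] := (nowhere_denseP (F i)).1 (ndF i) (g @^-1` W).
- by move/continuousP: cg; apply.
- by exists (f w); rewrite /preimage /= fK.
exists (f @^-1` V); split.
- by move/continuousP: cf; apply.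
- by exists (g v); rewrite /preimage /= gK.
- by move=> z /sV; rewrite /preimage /= fK.
- by rewrite -preimage_setI VF preimage_set0.
Qed.

(** * Meager upper limits *)

Lemma meager_lim_supS (T : topologicalType) (E O : (set T)^nat) :
  (forall k, meager (E k `\` O k)) ->
  meager (lim_sup_set O) -> meager (lim_sup_set E).
Proof.
move=> mEO mO; apply: meagerS (meagerU mO (meager_bigcup mEO)) => z zE.
have [|nz] := pselect ((\bigcup_i (E i `\` O i)) z); first by right.
left=> n _; have [k nk Ek] := zE n I; exists k => //.
by apply: contrapT => nO; apply: nz; exists k.
Qed.

(** The local condition makes the upper limit nowhere dense. Conversely, if it fails on some [W],
    every tail of [O] is dense in [W], and Baire's theorem gives a point of [W] in all tails but in
    no [closure (F n)]. *)
Lemma meager_lim_supP (K : realType) (T : completeNormedModType K)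
    (O : (set T)^nat) :
  (forall k, open (O k)) ->
  meager (lim_sup_set O) <->
  forall W : set T, open W -> W !=set0 -> exists W' : set T, exists p,
    [/\ open W', W' !=set0, W' `<=` W &
        forall k, (p <= k)%N -> W' `&` O k = set0].
Proof.
move=> oO; split=> [[F ndF OF] W oW W0|h]; last first.
  apply/nowhere_dense_meager/nowhere_denseP => W oW W0.
  have [W' [p [? ? ? W'O]]] := h W oW W0; exists W'; split => //.
  apply/seteqP; split=> // z [W'z /(_ p I)[k pk Okz]].
  by rewrite -(W'O _ pk).
apply: contrapT => nW.
have denseO p (Z : set T) : open Z -> Z !=set0 -> Z `<=` W ->
    exists2 k, (p <= k)%N & Z `&` O k !=set0.
  move=> oZ Z0 ZW; apply: contrapT => nk; apply: nW; exists Z, p; split=> // k pk.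
  by apply: contrapT => /eqP/set0P ?; apply: nk; exists k.
(* Baire's theorem asks for density in the whole space; adding the exterior of [W] secures it and
   changes nothing inside [W]. *)
pose G n := (\bigcup_(k >= n) O k `|` ~` closure W) `&` ~` closure (F n).
have [|z [Wz Gz]] := @Baire K T G _ W W0 oW.
  move=> n; split.
    apply: openI; last exact/closed_openC/closed_closure.
    apply: openU; last exact/closed_openC/closed_closure.
    exact: bigcup_open.
  move=> Z Z0 oZ.
  have [Z' [oZ' Z'0 sZ' Z'F]] := (nowhere_denseP (F n)).1 (ndF n) Z oZ Z0.
  have Z'cF z : Z' z -> ~ closure (F n) z.
    move=> Z'z /(_ _ (open_nbhs_nbhs (conj oZ' Z'z)))[y [Fy Z'y]].
    by have : (Z' `&` F n) y by []; rewrite Z'F.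
  have [Z'W|/set0P/negP/negPn/eqP Z'W] := pselect (Z' `&` W !=set0).
    have [|k nk [y [[Z'y Wy] Oy]]] := denseO n (Z' `&` W) (openI oZ' oW) Z'W.
      exact: subIsetr.
    exists y; split; first exact: sZ'.
    by split; [left; exists k|exact: Z'cF].
  have [z Z'z] := Z'0; exists z; split; first exact: sZ'.
  split; last exact: Z'cF.
  right=> /(_ _ (open_nbhs_nbhs (conj oZ' Z'z)))[y [Wy Z'y]].
  by have : (Z' `&` W) y by []; rewrite Z'W.
have : lim_sup_set O z.
  by move=> n _; have [[//|/(_ (subset_closure Wz))]] := Gz n I.
by rewrite OF => -[n _ Fz]; have [_] := Gz n I; apply; exact: subset_closure.
Qed.

(** * Ultrafilters and diagonal sequences *)

Lemma ultra_bigcup T (F : set_system T) (S : (set T)^nat) N :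
  UltraFilter F -> F (\bigcup_(j < N) S j) -> exists2 j, (j < N)%N & F (S j).
Proof.
move=> FU; elim: N => [|N IH].
  by rewrite bigcup_mkord big_ord0 => /filter_ex[].
rewrite bigcup_mkord big_ord_recr -bigcup_mkord /= => FS.
have [FN|FN] := in_ultra_setVsetC (S N) FU; first by exists N.
have [|j jN Fj] := IH; last by exists j => //; exact: ltnW.
by apply: filterS (filterI FS FN) => z [[//|]].
Qed.

Lemma filter_bigcap_lt T (F : set_system T) (S : (set T)^nat) N :
  Filter F -> (forall j, F (S j)) -> F (\bigcap_(j < N) S j).
Proof.
move=> FF FS; elim: N => [|N IH].
  by apply: filterS filterT => z _ j.
apply: filterS (filterI IH (FS N)) => z [h SN] j.
by rewrite /= ltnS leq_eqVlt => /orP[/eqP->//|]; exact: h.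
Qed.

(** Each [i k] is chosen beyond its predecessor in the intersection of [S 0], ..., [S k]; this set
    is in [F], hence unbounded, as [F] contains all cofinite sets. *)
Lemma increasing_pseudo_intersection (F : set_system nat) (S : (set nat)^nat) :
  ProperFilter F -> \oo `<=` F -> (forall l, F (S l)) ->
  exists2 i : nat^nat, increasing_seq i & forall l k, (l <= k)%N -> S l (i k).
Proof.
move=> PF oF FS.
have next (k a : nat) : exists b, (a < b)%N /\ forall l, (l <= k)%N -> S l b.
  have /filter_ex[b [ab Sb]] :
      F ([set b | (a < b)%N] `&` \bigcap_(l < k.+1) S l).
    apply: filterI; last exact: filter_bigcap_lt.
    by apply: oF; exists a.+1.
  by exists b.
have /choice[g hg] (ka : nat * nat) : exists b, (ka.2 < b)%N /\
  forall l, (l <= ka.1)%N -> S l b by exact: next.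
pose i := fix i k := if k is k'.+1 then g (k, i k') else g (0%N, 0%N).
exists i.
  by apply/increasing_seqP => k /=; have [] := hg (k.+1, i k).
by move=> l [|k] lk /=;
  [have [_] := hg (0%N, 0%N)|have [_] := hg (k.+1, i k)]; apply.
Qed.

(** * Countable pi-bases and the subsequence criterion *)

Definition pi_base (T : topologicalType) (B : (set T)^nat) :=
  (forall j, open (B j) /\ B j !=set0) /\
  forall W : set T, open W -> W !=set0 -> exists j, B j `<=` W.

Lemma pi_base_realType (R : realType) : exists B : (set R)^nat, pi_base B.
Proof.
(* Degenerate pairs get the whole line, so that every index yields a nonempty open set. *)
pose I (ab : rat * rat) : set R :=
  if ab.1 < ab.2 then `]ratr ab.1, ratr ab.2[%classic else setT.
exists (fun k => if unpickle k is Some ab then I ab else setT); split.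
  move=> k; case: unpickle => [[a b]|]; last by split; [exact: openT|exists 0].
  rewrite /I /=; case: ifPn => [ab|_]; last by split; [exact: openT|exists 0].
  split; first exact: interval_open.
  by exists (ratr ((a + b) / 2)); rewrite /= in_itv /= !ltr_rat !midf_lt.
move=> W oW [w Ww].
have /nbhs_ballP[e /= e0 eW] := open_nbhs_nbhs (conj oW Ww).
have [a] := @rat_in_itvoo R (w - e) w (ltac:(by rewrite ltrBlDr ltrDl)).
have [b] := @rat_in_itvoo R w (w + e) (ltac:(by rewrite ltrDl)).
rewrite !in_itv /= => /andP[wb be] /andP[ea aw].
have ab : a < b by rewrite -(ltr_rat R) (lt_trans aw).
exists (pickle (a, b)); rewrite pickleK /I /= ab => z /=.
rewrite in_itv /= => /andP[az zb]; apply: eW.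
by rewrite /ball /= ltr_distlC (lt_trans ea) //= (lt_trans zb).
Qed.

(** This trades quantifiers over sequences for quantifiers over numbers; the bound [j < N] later
    keeps unions of closed sets finite. *)
Lemma subsequences_meager_lim_supP (K : realType) (T : completeNormedModType K)
    (B O : (set T)^nat) :
  pi_base B -> (forall k, open (O k)) ->
  (forall n : nat^nat, (forall k, (0 < n k)%N) -> increasing_seq n ->
     exists2 i : nat^nat, increasing_seq i &
       meager (lim_sup_set (fun k => O (n (i k))))) <->
  forall l, exists N, forall m, (N < m)%N ->
    exists j, [/\ (j < N)%N, B j `<=` B l & B j `&` O m = set0].
Proof.
move=> [Bo BW] oO; split=> [h l|h n n0 ni].
  apply: contrapT => /forallNP nN.
  (* If no [N] works for [l], each [N] has a counterexample [g N]. *)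
  have /choice[g hg] N : exists m, (N < m)%N /\
      forall j, (j < N)%N -> B j `<=` B l -> B j `&` O m !=set0.
    have /existsNP[m /not_implyP[Nm nj]] := nN N; exists m; split=> // j jN jl.
    by apply: contrapT => e; apply: nj; exists j; split=> //;
      apply: contrapT => /eqP/set0P.
  (* For [k > 0], [O (n k)] meets every [B j] inside [B l] with [j < k]; the maximum with the
     previous term makes [n] increasing. *)
  pose n := fix n k := if k is k'.+1 then g (maxn k (n k')) else g 0%N.
  have ni : increasing_seq n.
    apply/increasing_seqP => k /=.
    by have [+ _] := hg (maxn k.+1 (n k)); rewrite gtn_max => /andP[].
  have [|i ii mi] := h n _ ni.
    by move=> [|k] /=; [have [] := hg 0%N|exact: leq_ltn_trans (hg _).1].
  have [W' [p [oW' W'0 W'l W'p]]] :=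
    (meager_lim_supP (fun k => oO (n (i k)))).1 mi (B l) (Bo l).1 (Bo l).2.
  have [j jW'] := BW W' oW' W'0.
  have le_i k : (k <= i k)%N.
    by elim: k => // k /leq_ltn_trans; apply; have /increasing_seqP := ii; apply.
  (* Past [p], [W'] misses the set; past [j], [B j] meets it. The successor also excludes
     [i k = 0]. *)
  pose k := (maxn p j).+1.
  have [] : B j `&` O (n (i k)) !=set0.
    have := le_i k; case: (i k) => [//|a] /= ka.
    have [_] := hg (maxn a.+1 (n a)); apply; last exact: subset_trans W'l.
    by rewrite leq_max (leq_trans _ ka) // /k ltnS (leq_trans (leq_maxr p j)).
  move=> z [/jW' W'z Oz]; have : (W' `&` O (n (i k))) z by [].
  by rewrite W'p //; apply: leqW; exact: leq_maxl.
have le_n k : (k <= n k)%N.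
  by elim: k => // k /leq_ltn_trans; apply; have /increasing_seqP := ni; apply.
(* A free ultrafilter selects one [j] for each [l], in place of a diagonal
   extraction. *)
have [F [FU oF]] := ultraFilterLemma eventually_filter.
have /choice[J hJ] l : exists j, B j `<=` B l /\
    F [set k | B j `&` O (n k) = set0].
  have [N hN] := h l.
  have [|j _ Fj] := @ultra_bigcup _ F
      (fun j => [set k | B j `<=` B l /\ B j `&` O (n k) = set0]) N FU.
    apply: oF; exists N.+1 => // k /= Nk.
    have [|j [jN jl jO]] := hN (n k); first exact: leq_trans (le_n k).
    by exists j.
  exists j; split; first by have /filter_ex[k []] := Fj.
  by apply: filterS Fj => k [].
(* One subsequence serves all [l]: from its [l]-th term on, the sets miss [B (J l)]. *)
have [i ii iJ] := increasing_pseudo_intersection _ oF (fun l => (hJ l).2).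
exists i => //; apply/meager_lim_supP => [k|W oW W0]; first exact: oO.
have [l lW] := BW W oW W0; exists (B (J l)), l; split.
- exact: (Bo _).1.
- exact: (Bo _).2.
- by apply: subset_trans lW; exact: (hJ l).1.
- by move=> k lk; exact: iJ.
Qed.

(** The exterior of [U] serves: the additional error lies in [closure U] minus [U], which is nowhere
    dense because [U] is open. *)
Lemma baire_propertyC_open (T : topologicalType) (A : set T) :
  baire_property A -> exists2 H : set T, open H & meager (~` A `+` H).
Proof.
move=> [U oU mAU]; exists (~` closure U).
  exact/closed_openC/closed_closure.
have ndU : nowhere_dense (closure U `\` U).
  apply/nowhere_denseP => W oW [w Ww].
  have [WU|/set0P/negP/negPn/eqP WU] := pselect (W `&` U !=set0).
    exists (W `&` U); split=> //; first exact: openI.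
    by apply/seteqP; split=> // z [[_ ?] []].
  exists W; split=> //; first by exists w.
  apply/seteqP; split=> // z [Wz [/(_ _ (open_nbhs_nbhs (conj oW Wz)))[y [Uy Wy]]]].
  by have : (W `&` U) y by []; rewrite WU.
apply: meagerS (meagerU mAU (nowhere_dense_meager ndU)) => z
  [[nA /contrapT cU]|[cU /contrapT Az]].
  have [Uz|nU] := pselect (U z); [by left; right|by right].
by left; left; split=> // Uz; apply: cU; exact: subset_closure.
Qed.

(** * Dilated translates *)

Section scaling.
Context {R : realType}.
Implicit Types (A H : set R) (x : R).

(** For [m > 0] this is the trace of [m (A - x)] on [(-1, 1)], written as a preimage so that
    continuity in [s] and in [x] can be used. *)
Definition scaled A x m : set R := `]-1, 1[ `&` [set s | A (x + s / m%:R)].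

Lemma continuous_addr_divr x (m : nat) : continuous (fun s : R => x + s / m%:R).
Proof.
by move=> s; apply: cvgD; [exact: cvg_cst|apply: cvgMr_tmp; exact: cvg_id].
Qed.

Lemma open_scaled H x m : open H -> open (scaled H x m).
Proof.
move=> oH; apply: openI; first exact: interval_open.
by have /continuousP := @continuous_addr_divr x m; apply.
Qed.

Lemma setD_dilate A x m : (0 < m)%N ->
  `]-1, 1[ `\` [set m%:R * t | t in [set t - x | t in A]] = scaled (~` A) x m.
Proof.
move=> m0; have m0' : m%:R != 0 :> R by rewrite pnatr_eq0 -lt0n.
apply/seteqP; split=> s [s1 nA]; split=> //.
  move=> As; apply: nA; exists (s / m%:R); last by rewrite mulrC divfK.
  by exists (x + s / m%:R) => //; rewrite addrC addKr.
move=> -[_ [t At <-] ts]; apply: nA.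
by rewrite -ts mulrAC mulfV // mul1r addrC subrK.
Qed.

(** The difference lies in the preimage of [A] minus [H] under an affine homeomorphism. *)
Lemma meager_scaledD A H x m : (0 < m)%N ->
  meager (A `\` H) -> meager (scaled A x m `\` scaled H x m).
Proof.
move=> m0 mAH; have m0' : m%:R != 0 :> R by rewrite pnatr_eq0 -lt0n.
apply: (@meagerS _ _ ((fun s => x + s / m%:R) @^-1` (A `\` H))).
  by move=> s [[s1 As] nH]; split=> // Hs; exact: nH.
apply: (@meager_preimage _ _ _ (fun t => (t - x) * m%:R)) mAH.
- exact: continuous_addr_divr.
- by move=> t; apply: cvgMr_tmp; apply: cvgB; [exact: cvg_id|exact: cvg_cst].
- by move=> s; rewrite addrC addKr divfK.
- by move=> t; rewrite mulfK // addrC subrK.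
Qed.

(** Each dilated set changes by a meager set only, so the same subsequence works in both
    directions. *)
Lemma Mdensity_pointP A H x : meager (~` A `+` H) ->
  Mdensity_point A x <->
  forall n : nat^nat, (forall k, (0 < n k)%N) -> increasing_seq n ->
    exists2 i : nat^nat, increasing_seq i &
      meager (lim_sup_set (fun k => scaled H x (n (i k)))).
Proof.
move=> mAH; split=> h n n0 ni; have [i ii mi] := h n n0 ni; exists i => //;
  apply: meager_lim_supS mi => k; rewrite setD_dilate //;
    apply: meager_scaledD => //.
  by apply: meagerS mAH; exact: subsetUr.
by apply: meagerS mAH; exact: subsetUl.
Qed.

(** For each witness [s] the condition on [x] is open, whatever [B] is; the set is the union over
    all [s]. *)
Lemma open_meet_scaled B H m : open H ->
  open [set x | B `&` scaled H x m !=set0].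
Proof.
move=> oH.
rewrite (_ : mkset _ =
  \bigcup_(s in B `&` `]-1, 1[) [set x | H (x + s / m%:R)]).
  apply: bigcup_open => s _.
  have : continuous (fun x : R => x + s / m%:R).
    by move=> x; apply: cvgD; [exact: cvg_id|exact: cvg_cst].
  by move=> /continuousP; apply.
apply/seteqP; split=> x.
  by move=> [s [Bs [s1 Hs]]]; exists s.
by move=> [s [Bs s1] Hs]; exists s.
Qed.

End scaling.

Theorem theorem4 (R : realType) (A : set R) :
  baire_property A -> Fsigmadelta (PhiM A).
Proof.
move=> /baire_propertyC_open[H oH mAH].
have [B Bpi] := pi_base_realType R.
(* Each [C l N] is closed, as an intersection of finite unions of closed sets; the quantifiers on
   [N] and [l] then give the countable union and intersection. *)
pose C l N := \bigcap_(m in [set m | (N < m)%N])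
  \bigcup_(j in [set j | (j < N)%N /\ B j `<=` B l])
    ~` [set x | B j `&` scaled H x m !=set0].
exists (fun l => \bigcup_N C l N).
  move=> l; exists (C l) => // N; apply: closed_bigI => m _.
  apply: closed_bigcup.
    by apply: (@sub_finite_set _ _ `I_N) => // j [].
  by move=> j _; apply: open_closedC; exact: open_meet_scaled.
apply/seteqP; split=> x; last first.
  move=> h; apply/(Mdensity_pointP x mAH).
  apply/(subsequences_meager_lim_supP (T := R^o) Bpi) => [m|l].
    exact: open_scaled.
  have [N _ hN] := h l I; exists N => m Nm; have [j [jN jl] jO] := hN m Nm.
  by exists j; split=> //; apply: contrapT => /eqP/set0P.
move=> /(Mdensity_pointP x mAH).
move=> /(subsequences_meager_lim_supP (T := R^o) Bpi) h l _.
have [|N hN] := h _ l; first by move=> m; exact: open_scaled.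
by exists N => // m /hN[j [jN jl jO]]; exists j => //=; rewrite jO => -[].
Qed.
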